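(* Let $s>1$. Let $f:\mathbb{N}\to\mathbb{C}$ be an arithmetic function such that $\sum_{n=1}^\infty f(n)/n^s$ converges absolutely, and let $a:\mathbb{N}\to\mathbb{C}$ be a multiplicative function such that $\sum_{k,n\ge1}\frac{|a(kn)|}{n^{s-1}}<\infty$. (i) If $f(n)=\sum_{q=1}^\infty a(q)c_q(n)$ converges absolutely (for each $n$), then $$\sum_{n=1}^\infty\frac{f(n)}{n^s}=\zeta(s)\prod_{p\in\mathcal{P}}\Big(\sum_{e\ge0}\frac{a(p^e)-a(p^{e+1})}{p^{e(s-1)}}\Big).$$ (ii) If $f(q)=\sum_{n=1}^\infty a(n)c_q(n)$ converges absolutely (for each $q$), then $$\sum_{q=1}^\infty\frac{f(q)}{q^s}=\frac{1}{\zeta(s)}\prod_{p\in\mathcal{P}}\Big(\sum_{e_1\ge0}\frac{\sum_{e_2\ge e_1}a(p^{e_2})}{p^{e_1(s-1)}}\Big).$$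
   Context: $\mathbb{N}=\{1,2,\dots\}$; $\mathcal{P}$ is the set of primes; $\zeta$ is the Riemann zeta function. $c_q(n)=\sum_{1\le k\le q,\,(k,q)=1}\exp(2\pi i kn/q)$ is the Ramanujan sum. $a$ multiplicative means $a(n_1n_2)=a(n_1)a(n_2)$ whenever $(n_1,n_2)=1$. *)

(* Defs.v *)
From HB Require Import structures.
From mathcomp Require Import all_boot all_order all_algebra.
From mathcomp Require Import complex.
From mathcomp Require Import all_classical all_reals all_analysis.

Set Implicit Arguments.
Unset Strict Implicit.
Unset Printing Implicit Defensive.

Import Order.TTheory GRing.Theory Num.Theory.
Import numFieldNormedType.Exports.

Local Open Scope classical_set_scope.
Local Open Scope complex_scope.
Local Open Scope ring_scope.

(* Arithmetic functions on {1, 2, ...} are total functions on nat whose value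
   at 0 is never used.  The topology on R[i] is the one induced by the complex
   modulus, carried by the alias R[i]^o. *)

Section Definitions.
Variable R : realType.
Implicit Types (u a F : nat -> R[i]) (z : R[i]).

Definition cmod z : R := ComplexField.Normc.normc z.

Definition partial_sum (m : nat) u : nat -> R[i]^o :=
  fun N => \sum_(m <= n < N) u n.

Definition summable_from (m : nat) u : Prop := cvgn (partial_sum m u).

Definition sum_from (m : nat) u : R[i] := limn (partial_sum m u).

Definition abs_summable_from (m : nat) u : Prop :=
  cvgn (fun N => \sum_(m <= n < N) cmod (u n) : R).

Definition prime_partial_prod F : nat -> R[i]^o :=
  fun N => \prod_(0 <= p < N | prime p) F p.

Definition prime_prod_cvg F : Prop := cvgn (prime_partial_prod F).

Definition prime_prod F : R[i] := limn (prime_partial_prod F).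

(* Only meaningful for 1 < s, where the series converges. *)
Definition zeta (s : R) : R := limn (series (riemannR s)).

Definition npow (n : nat) (t : R) : R[i] := (n%:R `^ t)%:C.

Definition expi (t : R) : R[i] := cos t +i* sin t.

Definition ramanujan_sum (q n : nat) : R[i] :=
  \sum_(1 <= k < q.+1 | coprime k q) expi (2 * pi * k%:R * n%:R / q%:R).

Definition is_multiplicative a : Prop :=
  forall m n : nat, (0 < m)%N -> (0 < n)%N -> coprime m n ->
    a (m * n)%N = a m * a n.

End Definitions.

(* Main.v *)
Require Import Defs.
From HB Require Import structures.
From mathcomp Require Import all_boot all_order all_algebra.
From mathcomp Require Import complex finmap.
From mathcomp Require Import all_classical all_reals all_analysis.
From mathcomp Require Import ring.
From mathcomp.analysis.showcase Require summability.

Set Implicit Arguments.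
Unset Strict Implicit.
Unset Printing Implicit Defensive.

Import Order.TTheory GRing.Theory Num.Theory.
Import numFieldNormedType.Exports.

Local Open Scope classical_set_scope.
Local Open Scope complex_scope.
Local Open Scope ring_scope.

(* By Kluyver's formula, c_q(n) is the sum over the common divisors d of q and n
   of d mu(q/d).  Put w1 = mu and w2 = 1 in case (i), w1 = 1 and w2 = mu in case
   (ii), and consider the triple series over d, k, m >= 1 with term
     a(dk) w1(k) w2(m) / (d^(s-1) m^s).
   It converges absolutely.  Grouping the triples by (dk, dm) turns it into the
   Dirichlet series of f; summing over m first and then grouping by n = dk turns
   it into the product of the Dirichlet series of w2, which is zeta(s) or
   1/zeta(s), and of the series with term a(n) (id^(1-s) * w1)(n), where * is
   Dirichlet convolution.  This term is multiplicative, hence its sum is an Euler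
   product, and resumming each local factor gives the stated form.
   All rearrangements are done with unordered sums: a sum over a type can be
   computed fiberwise along any map. *)

(** * Unordered sums *)

Local Notation totally := summability.totally.
#[local] Existing Instance summability.totally_filter.

Section UnorderedSum.
Variables (K : numFieldType) (V : normedModType K).
Implicit Types T S : choiceType.

(** Convergence along the directed set of finite subsets: no enumeration of [T] enters, so
    reindexing costs nothing. *)
Definition has_sum T (u : T -> V) (l : V) : Prop :=
  (fun A : {fset T} => \sum_(x <- A) u x) @ totally --> l.

Lemma has_sumP T (u : T -> V) (l : V) :
  has_sum u l <->
  forall e : K, 0 < e -> exists A0 : {fset T},
    forall A : {fset T}, (A0 `<=` A)%fset -> `|l - \sum_(x <- A) u x| <= e.
Proof.
split=> [/cvgrPdist_le h e /h [A0 _ hA0]|h]; first by exists A0 => A /hA0.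
by apply/cvgrPdist_le => e /h [A0 hA0]; exists A0 => // A /hA0.
Qed.

Lemma has_sum_unique T (u : T -> V) (l l' : V) :
  has_sum u l -> has_sum u l' -> l = l'.
Proof. by move=> h h'; exact: (cvg_unique (@norm_hausdorff _ V) h h'). Qed.

Lemma eq_has_sum T (u v : T -> V) (l : V) :
  u =1 v -> has_sum u l -> has_sum v l.
Proof. by move=> /funext ->. Qed.

Lemma has_sumD T (u v : T -> V) (k l : V) :
  has_sum u k -> has_sum v l -> has_sum (fun x => u x + v x) (k + l).
Proof.
move=> hu hv; rewrite /has_sum; under eq_fun do rewrite big_split.
exact: (cvgD hu hv).
Qed.

Lemma has_sumN T (u : T -> V) (l : V) :
  has_sum u l -> has_sum (fun x => - u x) (- l).
Proof.
move=> hu; rewrite /has_sum; under eq_fun do rewrite sumrN.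
exact: (cvgN hu).
Qed.

Lemma has_sumB T (u v : T -> V) (k l : V) :
  has_sum u k -> has_sum v l -> has_sum (fun x => u x - v x) (k - l).
Proof. by move=> hu hv; apply: has_sumD => //; exact: has_sumN. Qed.

Lemma has_sumZ T (u : T -> V) (l : V) (c : K) :
  has_sum u l -> has_sum (fun x => c *: u x) (c *: l).
Proof.
move=> hu; rewrite /has_sum; under eq_fun do rewrite -scaler_sumr.
by apply: cvgZ => //; exact: cvg_cst.
Qed.

Lemma has_sum_seq T (s : seq T) (u : T -> V) :
  uniq s -> (forall x, x \notin s -> u x = 0) -> has_sum u (\sum_(x <- s) u x).
Proof.
move=> us u0; apply/has_sumP => e e0; exists [fset x in s]%fset => A sA.
rewrite (_ : \sum_(x <- s) u x = \sum_(x <- [fset x in s]%fset) u x); last first.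
  by apply: perm_big; apply: uniq_perm => // x; rewrite !inE.
rewrite (big_fset_incl _ sA) ?subrr ?normr0 ?ltW// => x _.
by rewrite !inE; exact: u0.
Qed.

Lemma has_sum0 T (u : T -> V) : (forall x, u x = 0) -> has_sum u 0.
Proof.
move=> u0; have := @has_sum_seq T [::] u erefl (fun x _ => u0 x).
by rewrite big_nil.
Qed.

Lemma has_sum1 T (t : T) (u : T -> V) (l : V) :
  (forall x, x != t -> u x = 0) -> u t = l -> has_sum u l.
Proof.
move=> u0 <-; have := @has_sum_seq T [:: t] u erefl; rewrite big_seq1; apply=> x.
by rewrite inE; exact: u0.
Qed.

(* For large finite [G], the sum of the fibers over [G] is the limit of sums of
   [u] over finite sets that contain a given one. *)
Lemma has_sum_fiber T S (p : T -> S) (u : T -> V) (v : S -> V) (l : V) :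
  has_sum u l ->
  (forall i, has_sum (fun x => if p x == i then u x else 0) (v i)) ->
  has_sum v l.
Proof.
move=> /has_sumP hu hv; apply/has_sumP => e e0.
have e20 : 0 < e / 2 by rewrite divr_gt0.
have [A0 hA0] := hu _ e20; exists (p @` A0)%fset => G hG.
have : (fun A : {fset T} => \sum_(i <- G) \sum_(x <- A) (if p x == i then u x else 0))
   @ totally --> \sum_(i <- G) v i.
  by apply: cvg_big => [|i _]; [exact: add_continuous | exact: hv].
move=> /cvgrPdist_le /(_ _ e20) [A1 _ /(_ (A0 `|` A1)%fset)] /=.
rewrite fsubsetUr => /(_ isT) h1.
(* [B] contains [A0], because [G] contains the image of [A0]; and the sum of [u] over [B] is the sum
   over [G] of the fibers cut down to [A0] and [A1]. *)
set B := [fset x in (A0 `|` A1)%fset | p x \in G]%fset.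
rewrite (splitr e) (le_trans (ler_distD (\sum_(x <- B) u x) _ _))// lerD//.
  apply: hA0; apply/fsubsetP => x xA0; rewrite !inE xA0/=.
  by apply: (fsubsetP hG); apply/imfsetP; exists x.
move: h1; rewrite distrC exchange_big /= -big_fset_condE.
congr (`|_ - _| <= _); rewrite [RHS]big_mkcond; apply: eq_bigr => x _.
case: ifPn => xG; last first.
  by rewrite big_seq big1// => i iG; case: eqP => // pxi; rewrite pxi iG in xG.
rewrite (big_fsetD1 (p x)) //= eqxx big_seq big1 ?addr0// => i.
by rewrite !inE => /andP[/negbTE + _]; rewrite eq_sym => ->.
Qed.

(** The fiber of [j] over a point of [T] has at most one element, so [has_sum_fiber] along [j]
    applies. *)
Lemma has_sum_inj T S (j : S -> T) (u : T -> V) (l : V) :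
  injective j -> (forall t, (forall s, t != j s) -> u t = 0) ->
  has_sum (u \o j) l -> has_sum u l.
Proof.
move=> ij u0 h; apply: (has_sum_fiber (p := j) h) => t.
have [[s ->]|nt] := pselect (exists s, t = j s).
  by apply: (has_sum1 (t := s)) => [x xs|]; rewrite (inj_eq ij) ?(negbTE xs)// eqxx.
rewrite u0; last by move=> s; apply/eqP => ts; apply: nt; exists s.
by apply: has_sum0 => s; case: eqP => // tjs; case: nt; exists s.
Qed.

(** Fubini: the fibers of the first projection are the rows. *)
Lemma has_sum_prodl T S (u : T * S -> V) (v : T -> V) (l : V) :
  has_sum u l -> (forall i, has_sum (fun j => u (i, j)) (v i)) -> has_sum v l.
Proof.
move=> hu hv; apply: (has_sum_fiber (p := fst) hu) => i.
apply: (has_sum_inj (j := pair i)); first by move=> x y [].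
- by move=> [i' j] /= h; case: eqP => // ii'; move: (h j); rewrite ii' eqxx.
- by apply: eq_has_sum (hv i) => j /=; rewrite eqxx.
Qed.

Lemma has_sum_prodr T S (u : T * S -> V) (v : S -> V) (l : V) :
  has_sum u l -> (forall j, has_sum (fun i => u (i, j)) (v j)) -> has_sum v l.
Proof.
move=> hu hv; apply: (has_sum_fiber (p := snd) hu) => j.
apply: (has_sum_inj (j := fun i => (i, j))); first by move=> x y [].
- by move=> [i j'] /= h; case: eqP => // jj'; move: (h i); rewrite jj' eqxx.
- by apply: eq_has_sum (hv j) => i /=; rewrite eqxx.
Qed.

(** Used with initial segments, which gives ordinary partial sums, and with [N]-smooth numbers,
    which gives partial Euler products. The sets [P N] may be infinite. *)
Lemma has_sum_exhaust T (P : nat -> pred T) (u : T -> V) (w : nat -> V) (l : V) :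
  (forall x, u x != 0 -> \forall N \near \oo, P N x) ->
  has_sum u l ->
  (forall N, has_sum (fun x => if P N x then u x else 0) (w N)) ->
  w @ \oo --> l.
Proof.
move=> Pu /has_sumP hu hw; apply/cvgrPdist_le => e e0.
have e20 : 0 < e / 2 by rewrite divr_gt0.
have [A0 hA0] := hu _ e20.
have : \forall N \near \oo, forall x, x \in enum_fset A0 -> u x != 0 -> P N x.
  elim: (enum_fset A0) => [|x r IH]; first by apply: nearW => N x; rewrite inE.
  have [ux0|/Pu hx] := eqVneq (u x) 0.
    apply: filterS IH => N h y; rewrite !inE => /orP[/eqP ->|]; last exact: h.
    by rewrite ux0 eqxx.
  apply: filterS2 hx IH => N h1 h y; rewrite !inE => /orP[/eqP -> //|]; exact: h.
apply: filterS => N hN.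
have /has_sumP /(_ _ e20) [A1 /(_ (A0 `|` A1)%fset)] := hw N.
rewrite fsubsetUr => /(_ isT) h1.
(* Points of [A0] outside [P N] carry the value 0, so the truncated sum over [A0] and [A1] is the
   full sum of [u] over this set, which contains [A0]. *)
have h2 := hA0 (A0 `|` [fset x in A1 | P N x])%fset (fsubsetUl _ _).
rewrite (splitr e) (le_trans (ler_distD _ _ _) (lerD h2 _))// distrC.
move: h1; congr (`|_ - _| <= _); apply: esym.
transitivity (\sum_(x <- (A0 `|` [fset x in A1 | P N x])%fset)
    (if P N x then u x else 0)).
  apply: eq_big_seq => x; rewrite !inE => /orP[xA0|/andP[_ ->]//].
  by case: ifPn => // nP; apply/eqP; apply: contraNT nP; exact: hN.
apply: big_fset_incl.
  by apply/fsubsetP => x; rewrite !inE => /orP[->//|/andP[-> _]]; rewrite orbT.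
move=> x; rewrite !inE => /orP[-> //|-> /=].
by rewrite negb_or => /andP[_ /negbTE ->].
Qed.

Lemma has_sum_nat (u : nat -> V) (l : V) :
  has_sum u l -> (fun N => \sum_(0 <= n < N) u n) @ \oo --> l.
Proof.
move=> hu; apply: (has_sum_exhaust (P := fun N n => (n < N)%N)) hu _ => [n _|N].
  by exists n.+1.
rewrite (_ : \sum_(0 <= n < N) u n =
             \sum_(0 <= n < N) (if (n < N)%N then u n else 0)); last first.
  by apply: eq_big_nat => n /andP[_ ->].
apply: has_sum_seq; first exact: iota_uniq.
by move=> n; rewrite mem_index_iota /= => /negbTE ->.
Qed.

Lemma has_sum_from m (u : nat -> V) (l : V) :
  has_sum (fun n => if (m <= n)%N then u n else 0) l ->
  (fun N => \sum_(m <= n < N) u n) @ \oo --> l.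
Proof.
move=> /has_sum_nat h; under eq_fun do
  rewrite (@big_nat_widenl _ _ _ m 0)//= big_mkcond.
exact: h.
Qed.

End UnorderedSum.

Arguments has_sumZ {K V T u l} c _.

(** * Absolutely summable complex families *)

Section ComplexSum.
Variable R : realType.
Implicit Types T S : choiceType.

Local Notation C := (R[i]^o).
Local Notation has_csum := (@has_sum R[i] C _).

Lemma cmodE (z : R[i]) : `|z| = (cmod z)%:C.
Proof. by []. Qed.

Lemma cmodM (z w : R[i]) : cmod (z * w) = cmod z * cmod w.
Proof. exact: ComplexField.Normc.normcM. Qed.

Lemma cmod0 : cmod (0 : R[i]) = 0.
Proof. exact: ComplexField.Normc.normc0. Qed.

Lemma cmod_ge0 (z : R[i]) : 0 <= cmod z.
Proof. by rewrite -ler0c -cmodE. Qed.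

Lemma cmodD (z w : R[i]) : cmod (z + w) <= cmod z + cmod w.
Proof. by rewrite -lecR rmorphD /= -!cmodE ler_normD. Qed.

Lemma cmod_real (r : R) : cmod r%:C = `|r|.
Proof. by rewrite /cmod /= expr0n addr0 sqrtr_sqr. Qed.

Lemma cmod1 : cmod (1 : R[i]) = 1.
Proof. by rewrite -(rmorph1 (real_complex R)) cmod_real normr1. Qed.

Lemma cmodV (z : R[i]) : cmod z^-1 = (cmod z)^-1.
Proof. exact: ComplexField.Normc.normcV. Qed.

Lemma cmod_ge_Re (z : R[i]) : `|complex.Re z| <= cmod z.
Proof. by rewrite -lecR -cmodE normc_ge_Re. Qed.

Lemma cmod_ge_Im (z : R[i]) : `|complex.Im z| <= cmod z.
Proof.
case: z => x y; rewrite /cmod /= -sqrtr_sqr ler_sqrt ?lerDr ?sqr_ge0//.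
by rewrite addr_ge0 ?sqr_ge0.
Qed.

(** Bounded finite sums of moduli: this form passes directly to smaller families and along
    injections. *)
Definition abs_summable T (u : T -> R[i]) : Prop :=
  exists M : R, forall A : {fset T}, \sum_(x <- A) cmod (u x) <= M.

Lemma sum_fset_le T (A B : {fset T}) (v : T -> R) :
  (forall x, 0 <= v x) -> (A `<=` B)%fset ->
  \sum_(x <- A) v x <= \sum_(x <- B) v x.
Proof.
move=> v0 AB; rewrite (big_fsetID _ (mem A) B) /=.
rewrite (_ : [fset x in B | x \in A]%fset = A) ?lerDl ?sumr_ge0//.
apply/fsetP => x; rewrite !inE /=.
by case: (boolP (x \in A)) => xA; rewrite ?andbF// (fsubsetP AB).
Qed.

Lemma has_sum_ge0 T (v : T -> R) (M : R) :
  (forall x, 0 <= v x) -> (forall A : {fset T}, \sum_(x <- A) v x <= M) ->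
  exists l : R, has_sum (v : T -> R^o) l.
Proof.
move=> v0 vM; pose E := [set \sum_(x <- A) v x | A in [set: {fset T}]].
have supE : has_sup E.
  by split; [exists (\sum_(x <- fset0) v x), fset0 | exists M => _ [A _ <-]].
(* The sum of a nonnegative family is the supremum of its finite sums. *)
exists (sup E); apply/has_sumP => e e0.
have [_ [A0 _ <-] hA0] := sup_adherent e0 supE; exists A0 => A A0A.
have h1 : \sum_(x <- A) v x <= sup E by apply: (ub_le_sup supE.2); exists A.
rewrite ger0_norm ?subr_ge0// lerBlDr -lerBlDl (le_trans (ltW hA0))//.
exact: sum_fset_le.
Qed.

Lemma has_sum_abs_real T (v : T -> R) (M : R) :
  (forall A : {fset T}, \sum_(x <- A) `|v x| <= M) ->
  exists l : R, has_sum (v : T -> R^o) l.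
Proof.
move=> vM; have [k hk] := has_sum_ge0 (fun x => normr_ge0 (v x)) vM.
(* [v] is the difference of the nonnegative families [|v| + v] and [|v|], whose finite sums are
   bounded by [M + M] and [M]. *)
have [x|A|l hl] := @has_sum_ge0 T (fun x => `|v x| + v x) (M + M).
- by rewrite -lerBlDr sub0r -normrN ler_norm.
- rewrite big_split lerD// (le_trans _ (vM A))// ler_sum// => x _; exact: ler_norm.
exists (l - k); apply: (eq_has_sum _ (has_sumB hl hk)) => x.
by rewrite addrAC subrr add0r.
Qed.

Lemma has_sum_real_complex T (v : T -> R) (l : R) :
  has_sum (v : T -> R^o) l -> has_csum (fun x => (v x)%:C) l%:C.
Proof.
move=> /has_sumP h; apply/has_sumP => e.
(* In the order of [R[i]] a positive element is real, so the tolerance is a positive [r : R]. *)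
case: e => r y; rewrite ltcE /= => /andP[/eqP -> r0].
have [A0 hA0] := h _ r0; exists A0 => A /hA0.
by rewrite -rmorph_sum -rmorphB /= cmodE cmod_real lecR.
Qed.

Lemma abs_summable_has_sum T (u : T -> R[i]) :
  abs_summable u -> exists l : R[i], has_csum u l.
Proof.
move=> [M hM].
have [A|x hx] := @has_sum_abs_real T (fun t => complex.Re (u t)) M.
  by rewrite (le_trans _ (hM A))// ler_sum// => x _; exact: cmod_ge_Re.
have [A|y hy] := @has_sum_abs_real T (fun t => complex.Im (u t)) M.
  by rewrite (le_trans _ (hM A))// ler_sum// => t _; exact: cmod_ge_Im.
exists (x%:C + ('i : R[i]) *: (y%:C : C)).
apply: (eq_has_sum _ (has_sumD (has_sum_real_complex hx)
  (has_sumZ 'i%C (has_sum_real_complex hy)))) => t.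
by rewrite [RHS]complexE.
Qed.

Lemma abs_summable_le T (u v : T -> R[i]) :
  (forall x, cmod (u x) <= cmod (v x)) -> abs_summable v -> abs_summable u.
Proof.
by move=> uv [M hM]; exists M => A; rewrite (le_trans _ (hM A))// ler_sum.
Qed.

Lemma abs_summable_restrict T (P : pred T) (u : T -> R[i]) :
  abs_summable u -> abs_summable (fun x => if P x then u x else 0).
Proof.
by apply: abs_summable_le => x; case: ifP => // _; rewrite cmod0 cmod_ge0.
Qed.

Lemma abs_summable_inj T S (j : S -> T) (u : T -> R[i]) :
  injective j -> abs_summable u -> abs_summable (u \o j).
Proof.
move=> ij [M hM]; exists M => A.
rewrite (le_trans _ (hM (j @` A)%fset))// big_imfset//= => x y _ _; exact: ij.
Qed.

Lemma abs_summable_prod T S (u : T -> R[i]) (v : S -> R[i]) :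
  abs_summable u -> abs_summable v ->
  abs_summable (fun t : T * S => u t.1 * v t.2).
Proof.
move=> [M hM] [N hN]; exists (M * N) => A.
have M0 : 0 <= M by have := hM fset0; rewrite big_seq_fset0.
pose A1 := [fset t.1 | t in A]%fset; pose A2 := [fset t.2 | t in A]%fset.
pose B := (A1 `*` A2)%fset.
(* The set [A] lies in the rectangle spanned by its two projections, over which the sum factors. *)
apply: (@le_trans _ _ (\sum_(t <- B) cmod (u t.1 * v t.2))).
  apply: sum_fset_le => [t|]; first exact: cmod_ge0.
  apply/fsubsetP => -[x y] xyA; rewrite in_fsetM /=.
  by apply/andP; split; apply/imfsetP; exists (x, y).
rewrite big_imfset2 /=; last by move=> [x y] [x' y'] _ _ /= [-> ->].
rewrite (eq_bigr (fun x => cmod (u x) * \sum_(y <- A2) cmod (v y))).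
  by rewrite -mulr_suml ler_pM// sumr_ge0// => x _; exact: cmod_ge0.
by move=> x _; rewrite mulr_sumr; apply: eq_bigr => y _; rewrite cmodM.
Qed.

(** Absolute summability provides some sum [m] of the product family; summing by rows identifies it
    as [k * l]. *)
Lemma has_sum_prod T S (u : T -> R[i]) (v : S -> R[i]) (k l : R[i]) :
  abs_summable u -> abs_summable v ->
  has_csum u k -> has_csum v l ->
  has_csum (fun t : T * S => u t.1 * v t.2) (k * l).
Proof.
move=> au av hu hv; have [m hm] := abs_summable_has_sum (abs_summable_prod au av).
have h1 := has_sum_prodl hm (fun i => has_sumZ (u i) hv).
rewrite (_ : k * l = m)// mulrC; apply: has_sum_unique _ h1.
by apply: (eq_has_sum _ (has_sumZ l hu)) => x; rewrite [LHS]mulrC.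
Qed.

(** Brings the hypothesis on [a], a sum of extended reals, into the form used here. *)
Lemma abs_summable_esum T (D : set T) (u : T -> R) :
  (forall x, D x -> 0 <= u x) -> (\esum_(x in D) (u x)%:E < +oo)%E ->
  abs_summable (fun x => if x \in D then (u x)%:C else 0).
Proof.
move=> u0 h.
have hfin : (\esum_(x in D) (u x)%:E)%E \is a fin_num.
  by rewrite ge0_fin_numE// esum_ge0// => x Dx; rewrite lee_fin u0.
exists (fine (\esum_(x in D) (u x)%:E)%E) => A.
rewrite -lee_fin fineK//; apply: esum_ge.
exists [set` [fset x in A | x \in D]%fset].
  by split=> [|x /=]; [exact: finite_fset | rewrite !inE => /andP[_]; rewrite inE].
rewrite -fsbig_seq ?fset_uniq// -sumEFin -big_fset_condE.
rewrite [leRHS]big_mkcond le_eqVlt; apply/orP; left.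
apply/eqP; apply: eq_bigr => x _.
by case: ifPn => [/set_mem Dx|_]; rewrite ?cmod0// cmod_real ger0_norm// u0.
Qed.

(** The passage from unordered sums to the ordered series of the statement. *)
Lemma sum_fromE m (u : nat -> R[i]) (l : R[i]) :
  has_csum (fun n => if (m <= n)%N then u n else 0) l ->
  summable_from m u /\ sum_from m u = l.
Proof.
move=> /has_sum_from h; split; first by apply/cvg_ex; exists l.
exact: (cvg_lim (@norm_hausdorff _ C) h).
Qed.

End ComplexSum.

(** * Divisor sums and Ramanujan sums *)

Section Divisors.

Lemma perm_divisors_mul (m n : nat) :
  (0 < m)%N -> (0 < n)%N -> coprime m n ->
  perm_eq (divisors (m * n)) [seq (d * e)%N | d <- divisors m, e <- divisors n].
Proof.
move=> m0 n0 cmn; have mn0 : (0 < m * n)%N by rewrite muln_gt0 m0.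
apply: uniq_perm; first exact: divisors_uniq.
  apply: allpairs_uniq; try exact: divisors_uniq.
  move=> [d e] [d' e'] /allpairsP[[a b] /= [ha hb [-> ->]]].
  move=> /allpairsP[[c f] /= [hc hf [-> ->]]] /= h.
  rewrite -dvdn_divisors // in ha; rewrite -dvdn_divisors // in hb.
  rewrite -dvdn_divisors // in hc; rewrite -dvdn_divisors // in hf.
  have cross x y : (x %| m)%N -> (y %| n)%N -> coprime x y.
    by move=> xm yn; exact: coprime_dvdl xm (coprime_dvdr yn cmn).
  have ac : a = c.
    apply/eqP; rewrite eqn_dvd; apply/andP; split.
      by rewrite -(Gauss_dvdl _ (cross _ _ ha hf)) -h dvdn_mulr.
    by rewrite -(Gauss_dvdl _ (cross _ _ hc hb)) h dvdn_mulr.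
  have c0 : (0 < c)%N by rewrite (dvdn_gt0 m0).
  by congr (_, _) => //; apply/eqP; rewrite -(eqn_pmul2l c0) -h ac.
move=> d; rewrite -dvdn_divisors//; apply/idP/allpairsP => [dmn|].
  (* A divisor [d] of [m * n] splits into [gcdn d m] and its cofactor, which divides [n]. *)
  have dg : (gcdn d m %| d)%N by exact: dvdn_gcdl.
  have g0 : (0 < gcdn d m)%N by rewrite gcdn_gt0 m0 orbT.
  exists (gcdn d m, d %/ gcdn d m)%N; split => /=.
  - by rewrite -dvdn_divisors// dvdn_gcdr.
  - by rewrite -dvdn_divisors// dvdn_divLR// mulnC muln_gcdl dvdn_gcd dmn dvdn_mulr.
  - by rewrite mulnC divnK.
by move=> [[a b] /= [+ + ->]]; rewrite -!dvdn_divisors//; exact: dvdn_mul.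
Qed.

Lemma perm_divisors_pfactor (p e : nat) :
  prime p -> perm_eq (divisors (p ^ e)) [seq (p ^ i)%N | i <- index_iota 0 e.+1].
Proof.
move=> pp; apply: uniq_perm; first exact: divisors_uniq.
  rewrite map_inj_uniq ?iota_uniq// => i j /eqP.
  by rewrite eqn_exp2l ?prime_gt1// => /eqP.
move=> d; rewrite -dvdn_divisors ?expn_gt0 ?prime_gt0//.
apply/(dvdn_pfactor _ _ pp)/mapP => -[ i ].
  by move=> ie ->; exists i => //; rewrite mem_index_iota.
by rewrite mem_index_iota /= => ie ->; exists i.
Qed.

Lemma divn_divn_dvd (n d : nat) : (0 < n)%N -> (d %| n)%N -> (n %/ (n %/ d))%N = d.
Proof. by move=> n0 dn; rewrite divnA// mulKn. Qed.

Lemma perm_divisors_div (n : nat) :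
  (0 < n)%N -> perm_eq (divisors n) [seq (n %/ d)%N | d <- divisors n].
Proof.
move=> n0; apply: uniq_perm; first exact: divisors_uniq.
  rewrite map_inj_in_uniq ?divisors_uniq// => d e.
  rewrite -!dvdn_divisors// => dn en h.
  by rewrite -(divn_divn_dvd n0 dn) h divn_divn_dvd.
move=> d; rewrite -dvdn_divisors//; apply/idP/mapP => [dn|[e]].
  exists (n %/ d)%N; last by rewrite divn_divn_dvd.
  by rewrite -dvdn_divisors// dvdn_div.
by rewrite -dvdn_divisors// => en ->; exact: dvdn_div.
Qed.

Lemma perm_divisors_gcd (m n : nat) :
  (0 < m)%N -> perm_eq (divisors (gcdn m n)) [seq d <- divisors m | (d %| n)%N].
Proof.
move=> m0; apply: uniq_perm => [||d]; rewrite ?filter_uniq ?divisors_uniq//.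
by rewrite mem_filter -!dvdn_divisors ?gcdn_gt0 ?m0// dvdn_gcd andbC.
Qed.

Lemma perm_multiples (e m : nat) : (0 < e)%N ->
  perm_eq [seq k <- index_iota 1 (e * m).+1 | (e %| k)%N]
          [seq (e * j)%N | j <- index_iota 1 m.+1].
Proof.
move=> e0; apply: uniq_perm; first by rewrite filter_uniq// iota_uniq.
  rewrite map_inj_uniq ?iota_uniq// => i j /eqP.
  by rewrite eqn_pmul2l// => /eqP.
move=> k; rewrite mem_filter mem_index_iota; apply/andP/mapP.
  move=> [/dvdnP[j ->]]; rewrite muln_gt0 mulnC ltnS leq_pmul2l//.
  move=> /andP[/andP[j0 _] jm].
  by exists j => //; rewrite mem_index_iota j0.
move=> [j + ->]; rewrite mem_index_iota => /andP[j0 jm].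
by rewrite dvdn_mulr// muln_gt0 e0 j0 ltnS leq_pmul2l.
Qed.

End Divisors.

(** * Dirichlet convolution and the Möbius function *)

Section Convolution.
Variable R : realType.
Implicit Types f g : nat -> R[i].

Definition dconv f g (n : nat) : R[i] :=
  \sum_(d <- divisors n) f d * g (n %/ d)%N.

Lemma dconv_multiplicative f g :
  is_multiplicative f -> is_multiplicative g -> is_multiplicative (dconv f g).
Proof.
move=> mf mg m n m0 n0 cmn; rewrite /dconv (perm_big _ (perm_divisors_mul m0 n0 cmn)).
rewrite big_allpairs_dep big_distrlr /=; apply: eq_big_seq => d.
rewrite -dvdn_divisors// => /dvdnP[d' md]; apply: eq_big_seq => e.
rewrite -dvdn_divisors// => /dvdnP[e' ne]; subst m n.
move: m0 n0; rewrite !muln_gt0 => /andP[d'0 d0] /andP[e'0 e0].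
rewrite mulnACA !mulnK ?muln_gt0 ?d0//.
have cross x y : (x %| d' * d)%N -> (y %| e' * e)%N -> coprime x y.
  by move=> xm yn; exact: coprime_dvdl xm (coprime_dvdr yn cmn).
have cde : coprime d e by rewrite cross ?dvdn_mull.
have cde' : coprime d' e' by rewrite cross ?dvdn_mulr.
by rewrite mf// mg// mulrACA.
Qed.

Lemma dconv_pfactor f g (p e : nat) : prime p ->
  dconv f g (p ^ e) = \sum_(0 <= i < e.+1) f (p ^ i)%N * g (p ^ (e - i))%N.
Proof.
move=> pp; rewrite /dconv (perm_big _ (perm_divisors_pfactor e pp)) big_map.
apply: eq_big_nat => i /andP[_ ie].
by rewrite -expnB// prime_gt0.
Qed.

(** The Möbius function: an exponent of at least 2 contributes a factor 0, and each simple prime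
    factor a sign. *)
Definition mobius (n : nat) : R[i] :=
  \prod_(p <- primes n) (if logn p n == 1%N then -1 else 0).

Lemma mobius_multiplicative : is_multiplicative mobius.
Proof.
move=> m n m0 n0 cmn; rewrite /mobius.
rewrite (perm_big (primes m ++ primes n)); last first.
  apply: uniq_perm; first exact: primes_uniq.
    rewrite cat_uniq !primes_uniq /= andbT.
    by rewrite coprime_has_primes in cmn.
  by move=> p; rewrite mem_cat primesM.
rewrite big_cat /=; congr (_ * _); apply: eq_big_seq => p.
  rewrite mem_primes => /and3P[pp _ pm]; rewrite mulnC logn_Gauss//.
  exact: coprime_dvdl pm cmn.
rewrite mem_primes => /and3P[pp _ pm]; rewrite logn_Gauss//.
by apply: coprime_dvdl pm _; rewrite coprime_sym.
Qed.

Lemma mobius1 : mobius 1 = 1.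
Proof. by rewrite /mobius big_nil. Qed.

Lemma mobius_pfactor (p e : nat) : prime p ->
  mobius (p ^ e.+1) = if e == 0%N then -1 else 0.
Proof.
by move=> pp; rewrite /mobius primesX// primes_prime// big_seq1 pfactorK.
Qed.

Lemma cmod_mobius (n : nat) : cmod (mobius n) <= 1.
Proof.
rewrite /mobius; elim/big_rec: _ => [|p x _ IH].
  by rewrite cmod1.
case: ifP => _; last by rewrite mul0r cmod0.
by rewrite mulN1r /cmod normcN.
Qed.

Lemma cst1_multiplicative : is_multiplicative (fun=> 1 : R[i]).
Proof. by move=> m n _ _ _; rewrite mul1r. Qed.

Lemma sum_mobius (n : nat) : (0 < n)%N ->
  \sum_(d <- divisors n) mobius d = (n == 1%N)%:R.
Proof.
move=> n0; rewrite (_ : \sum_(d <- _) _ = dconv mobius (fun=> 1) n); last first.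
  by apply: eq_bigr => d _; rewrite mulr1.
have [->|n1] := eqVneq n 1%N; first by rewrite /dconv big_seq1 mobius1 mulr1.
(* By multiplicativity it is enough that the factor at one prime power vanishes; at the least prime
   factor of [n] it is [1 - 1], followed by zeros. *)
have pp : prime (pdiv n) by rewrite pdiv_prime// ltn_neqAle eq_sym n1.
have [m cpm nE] := pfactor_coprime pp n0.
move: (n0); rewrite {1}nE muln_gt0 => /andP[m0 pn0].
rewrite nE (dconv_multiplicative mobius_multiplicative cst1_multiplicative)//; last first.
  by rewrite coprime_sym coprimeXl.
rewrite dconv_pfactor//; have : (0 < logn (pdiv n) n)%N.
  by rewrite -pfactor_dvdn// expn1 pdiv_dvd.
case: logn => // e _; rewrite big_nat_recl// big_nat_recl// expn0 mobius1.
rewrite mobius_pfactor// big1_seq ?addr0 ?mulr1 ?subrr ?mulr0// => i _.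
by rewrite mobius_pfactor// mul0r.
Qed.

End Convolution.

(** * Roots of unity and Kluyver's formula *)

Section Ramanujan.
Variable R : realType.

Lemma expiD (x y : R) : expi (x + y) = expi x * expi y.
Proof.
by rewrite /expi cosD sinD; apply/eqP; rewrite eq_complex /= eqxx addrC eqxx.
Qed.

Lemma expi0 : expi (0 : R) = 1.
Proof. by rewrite /expi cos0 sin0. Qed.

Lemma expiMn (x : R) (n : nat) : expi (x *+ n) = expi x ^+ n.
Proof. by elim: n => [|n IH]; rewrite ?mulr0n ?expi0// mulrS expiD IH exprS. Qed.

Lemma expi2pi (n : nat) : expi (2 * pi * n%:R : R) = 1.
Proof.
by rewrite mulr_natr expiMn mulr_natl /expi cos2pi sin2pi expr1n.
Qed.

Lemma expi_neq1 (x : R) : 0 < x < 2 * pi -> expi x != 1.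
Proof.
move=> /andP[x0 x2pi]; rewrite eq_complex /= negb_and; apply/orP; left.
(* The real part already differs from 1, since the sine of [x / 2] is positive. *)
have -> : cos x = 1 - sin (x / 2) ^+ 2 *+ 2.
  have {1}-> : x = (x / 2) *+ 2 by rewrite -mulr_natr divfK.
  by rewrite cos_mulr2n cos2sin2; ring.
have s0 : 0 < sin (x / 2).
  by apply: sin_gt0_pi; rewrite divr_gt0//= ltr_pdivrMr// mulrC.
by rewrite lt_eqF// gtrDl oppr_lt0 pmulrn_lgt0// exprn_gt0.
Qed.

(** A geometric sum with ratio [w], an [m]-th root of unity: either [w] is 1, or [w - 1] times the
    sum is [w ^+ m - 1 = 0]. *)
Lemma sum_expi (m n : nat) : (0 < m)%N ->
  \sum_(1 <= j < m.+1) expi (2 * pi * j%:R * n%:R / m%:R : R) =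
  if (m %| n)%N then m%:R else 0.
Proof.
move=> m0; have m0' : m%:R != 0 :> R by rewrite pnatr_eq0 -lt0n.
set w := expi (2 * pi * n%:R / m%:R : R).
have wm : w ^+ m = 1.
  by rewrite -expiMn -[_ *+ m]mulr_natr divfK// expi2pi.
rewrite big_add1 (eq_bigr (fun j => w * w ^+ j)); last first.
  move=> j _; rewrite -exprS -expiMn -[_ *+ j.+1]mulr_natr; congr expi.
  by field.
rewrite -mulr_sumr big_mkord.
(* Dropping full turns reduces [n] modulo [m]; if [m] does not divide [n], the remaining angle lies
   strictly between 0 and [2 * pi], as [expi_neq1] requires. *)
have nE : 2 * pi * n%:R / m%:R = 2 * pi * (n %/ m)%:R + 2 * pi * (n %% m)%:R / m%:R :> R.
  rewrite {1}(divn_eq n m) natrD natrM; field.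
  exact: m0'.
rewrite {}/w {}nE expiD expi2pi mul1r in wm *.
case: ifPn => [/eqP ->|nm]; last first.
  have w1 : expi (2 * pi * (n %% m)%:R / m%:R : R) != 1.
    apply: expi_neq1; rewrite divr_gt0 ?mulr_gt0 ?pi_gt0 ?ltr0n //= ?lt0n //.
    by rewrite ltr_pdivrMr ?ltr0n// ltr_pM2l ?mulr_gt0 ?pi_gt0// ltr_nat ltn_mod.
  apply/eqP; rewrite mulf_eq0; apply/orP; right.
  have /eqP := subrX1 (expi (2 * pi * (n %% m)%:R / m%:R : R)) m.
  by rewrite wm subrr eq_sym mulf_eq0 subr_eq0 (negbTE w1).
rewrite mulr0 mul0r expi0 mul1r (eq_bigr (fun=> 1)); first by rewrite sumr_const card_ord.
by move=> j _; rewrite expr1n.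
Qed.

Lemma ramanujan_sumE (q n : nat) : (0 < q)%N ->
  ramanujan_sum R q n =
  \sum_(d <- divisors (gcdn q n)) d%:R * mobius R (q %/ d).
Proof.
move=> q0; pose F k : R[i] := expi (2 * pi * k%:R * n%:R / q%:R).
(* The coprimality condition is replaced by the sum of [mobius] over the common divisors of [k] and
   [q]. *)
transitivity (\sum_(1 <= k < q.+1) \sum_(e <- divisors q | (e %| k)%N) mobius R e * F k).
  rewrite /ramanujan_sum big_mkcond; apply: eq_bigr => k _.
  rewrite -big_filter -(perm_big _ (perm_divisors_gcd k q0)) -mulr_suml.
  rewrite sum_mobius ?gcdn_gt0 ?q0// /coprime gcdnC.
  by case: ifP => _; rewrite ?mul1r ?mul0r.
rewrite (exchange_big_dep xpredT) //=.
rewrite (perm_big _ (perm_divisors_gcd n q0)) big_filter.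
(* With [d = q %/ e] on the right, both sides run over the divisors [e] of [q]. For fixed [e] the
   left side has [k = e * j], and [sum_expi] with modulus [q %/ e] evaluates it. *)
rewrite [RHS](perm_big _ (perm_divisors_div q0)) big_map [RHS]big_mkcond /=.
apply: eq_big_seq => e; rewrite -dvdn_divisors// => eq.
rewrite divn_divn_dvd// -mulr_sumr -big_filter.
have e0 : (0 < e)%N by rewrite (dvdn_gt0 q0).
have qe0 : (0 < q %/ e)%N by rewrite divn_gt0// dvdn_leq.
rewrite -{1}(divnK eq) mulnC (perm_big _ (perm_multiples _ e0)) big_map.
rewrite (eq_bigr (fun j => expi (2 * pi * j%:R * n%:R / (q %/ e)%:R))).
  by rewrite sum_expi//; case: ifP => _; rewrite ?mulr0// mulrC.
move=> j _; congr expi; rewrite -{1}(divnK eq) !natrM; field.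
by rewrite !pnatr_eq0 -!lt0n e0 qe0.
Qed.

End Ramanujan.

(** * Euler products *)

Section Euler.
Variable R : realType.
Local Notation C := (R[i]^o).
Local Notation has_csum := (@has_sum R[i] C _).

Lemma abs_summable_seq (T : choiceType) (u : T -> R[i]) :
  abs_summable u ->
  exists M : R, forall r : seq T, uniq r -> \sum_(x <- r) cmod (u x) <= M.
Proof.
move=> [M hM]; exists M => r ur; rewrite (le_trans _ (hM [fset x in r]%fset))//.
rewrite le_eqVlt; apply/orP; left; apply/eqP; apply: perm_big.
by apply: uniq_perm => // x; rewrite !inE.
Qed.

(** Every finite set of naturals lies in an initial segment. *)
Lemma abs_summable_nat (u : nat -> R[i]) (M : R) :
  (forall N, \sum_(0 <= n < N) cmod (u n) <= M) -> abs_summable u.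
Proof.
move=> hM; exists M => A; pose N := (\max_(n <- A) n).+1.
rewrite (le_trans _ (hM N))//.
rewrite (_ : \sum_(0 <= n < N) _ =
    \sum_(n <- [fset n in index_iota 0 N]%fset) cmod (u n)).
  apply: sum_fset_le => [n|]; first exact: cmod_ge0.
  apply/fsubsetP => n nA; rewrite in_fset /= mem_index_iota /= ltnS.
  by rewrite (big_fsetD1 n)//= leq_maxl.
by apply: perm_big; apply: uniq_perm => [||n]; rewrite ?iota_uniq ?fset_uniq// in_fset.
Qed.

Lemma abs_summable_from_restrict m (u : nat -> R[i]) :
  abs_summable_from m u ->
  abs_summable (fun n => if (m <= n)%N then u n else 0).
Proof.
move=> hu; pose M := limn (fun N => \sum_(m <= n < N) cmod (u n) : R).
apply: (@abs_summable_nat _ M) => N.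
rewrite (le_trans _ (nondecreasing_cvgn_le _ hu N))//.
  rewrite (@big_nat_widenl _ _ _ m 0)// [leRHS]big_mkcond /= ler_sum// => n _.
  by case: ifP; rewrite ?cmod0.
apply/nondecreasing_seqP => n; case: (leqP m n) => mn.
  by rewrite big_nat_recr//= lerDl cmod_ge0.
by rewrite !big_geq// ltnW.
Qed.

(** Fibers of multiplication. The fiber over 0 is infinite and consists of pairs with a zero
    coordinate, hence the vanishing hypothesis. *)
Lemma has_csum_divisors (u : nat * nat -> R[i]) (l : R[i]) :
  (forall k m, (k == 0) || (m == 0)%N -> u (k, m) = 0) ->
  has_csum u l ->
  has_csum (fun n => \sum_(d <- divisors n) u (d, n %/ d)%N) l.
Proof.
move=> u0 hu; apply: (has_sum_fiber (p := fun t => (t.1 * t.2)%N) hu) => n.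
have [->|n0] := posnP n.
  rewrite big1_seq => [|d _]; last by rewrite div0n u0 ?orbT.
  apply: has_sum0 => -[k m] /=; case: ifP => //.
  by rewrite muln_eq0; exact: u0.
pose r := [seq (d, n %/ d)%N | d <- divisors n].
have ur : uniq r by rewrite map_inj_uniq ?divisors_uniq// => x y [].
rewrite (_ : \sum_(d <- divisors n) u (d, n %/ d)%N =
  \sum_(t <- r) (if (t.1 * t.2)%N == n then u t else 0)).
  apply: has_sum_seq => // -[k m] kmr /=; case: eqP => // kmn.
  case/negP: kmr; apply/mapP; exists k.
    by rewrite -dvdn_divisors// -kmn dvdn_mulr.
  by rewrite -kmn mulKn//; move: n0; rewrite -kmn muln_gt0 => /andP[].
rewrite big_map; apply: eq_big_seq => d; rewrite -dvdn_divisors// => dn /=.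
by rewrite mulnC divnK// eqxx.
Qed.

(** Distinct positive [n] have disjoint lists of pairs [(d, n %/ d)], so a finite sum is bounded by
    one over a duplicate-free list of pairs. *)
Lemma abs_summable_divisors (u : nat * nat -> R[i]) :
  (forall k m, (k == 0) || (m == 0)%N -> u (k, m) = 0) ->
  abs_summable u ->
  abs_summable (fun n => \sum_(d <- divisors n) u (d, n %/ d)%N).
Proof.
move=> u0 /abs_summable_seq [M hM]; exists M => A.
pose r := [seq (d, n %/ d)%N | n <- [seq n <- A | (0 < n)%N], d <- divisors n].
apply: le_trans (hM r _); last first.
  apply: allpairs_uniq_dep; first exact: filter_uniq (fset_uniq A).
    by move=> n _; exact: divisors_uniq.
  move=> _ _ /allpairsPdep[n [d [+ + ->]]] /allpairsPdep[n' [d' [+ + ->]]] /=.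
  rewrite !mem_filter => /andP[n0 _] + /andP[n'0 _].
  rewrite -!dvdn_divisors// => dn dn' [dd' h].
  have nn' : n = n' by rewrite -[LHS](divnK dn) -[RHS](divnK dn') h dd'.
  by rewrite nn' dd'.
rewrite big_allpairs_dep big_filter [leRHS]big_mkcond /= ler_sum// => n _.
case: ifPn => n0; last first.
  rewrite big1_seq ?cmod0// => d _; move: n0; rewrite lt0n negbK => /eqP ->.
  by rewrite div0n u0 ?orbT.
elim/big_ind2: _ => [|x x' y y' hx hy|//]; first by rewrite cmod0.
by rewrite (le_trans (cmodD _ _))// lerD.
Qed.

(** Groups the triples [(d, k, m)] by [(d * k, d * m)]; over a pair of positive numbers the fiber is
    indexed by the common divisors [d]. *)
Lemma has_csum_gcd (u : nat * nat * nat -> R[i]) (l : R[i]) :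
  (forall d k m, [|| d == 0, k == 0 | m == 0]%N -> u (d, k, m) = 0) ->
  has_csum u l ->
  has_csum (fun t : nat * nat =>
    \sum_(d <- divisors (gcdn t.1 t.2)) u (d, t.1 %/ d, t.2 %/ d)%N) l.
Proof.
move=> u0 hu.
pose p (t : nat * nat * nat) := (t.1.1 * t.1.2, t.1.1 * t.2)%N.
apply: (has_sum_fiber (p := p) hu) => -[x y].
have [xy0|] := boolP ((x == 0) || (y == 0))%N.
  rewrite big1_seq => [|d _]; last first.
    by rewrite u0//=; case/orP: xy0 => /eqP ->; rewrite div0n eqxx ?orbT.
  apply: has_sum0 => -[[d k] m] /=; case: eqP => //= -[dkx dmy].
  by apply: u0; move: xy0; rewrite -dkx -dmy !muln_eq0; case: eqP.
rewrite negb_or -!lt0n => /andP[x0 y0].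
have g0 : (0 < gcdn x y)%N by rewrite gcdn_gt0 x0.
pose r := [seq (d, x %/ d, y %/ d)%N | d <- divisors (gcdn x y)].
have ur : uniq r by rewrite map_inj_uniq ?divisors_uniq// => ? ? [].
rewrite (_ : \sum_(d <- _) _ = \sum_(t <- r) (if p t == (x, y) then u t else 0)).
  apply: has_sum_seq => // -[[d k] m] kmr /=; case: eqP => //= -[dkx dmy].
  have d0 : (0 < d)%N by move: x0; rewrite -dkx muln_gt0 => /andP[].
  case/negP: kmr; apply/mapP; exists d; last by rewrite -dkx -dmy !mulKn.
  by rewrite -dvdn_divisors// dvdn_gcd -dkx -dmy !dvdn_mulr.
rewrite big_map; apply: eq_big_seq => d /=; rewrite -dvdn_divisors// dvdn_gcd.
by move=> /andP[dx dy]; rewrite /p /= ![(d * _)%N]mulnC !divnK// eqxx.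
Qed.

(** * Smooth numbers *)

Definition smooth (N n : nat) : bool := all (fun p => p < N)%N (primes n).

Lemma smoothS_not_prime (N n : nat) : ~~ prime N -> smooth N.+1 n = smooth N n.
Proof.
move=> pN; apply: eq_in_all => p; rewrite mem_primes => /andP[pp _].
by rewrite ltnS leq_eqVlt; case: eqP pp pN => [-> ->|].
Qed.

Lemma smooth_mul_pfactor (p e m : nat) : prime p -> (0 < m)%N ->
  smooth p m -> smooth p.+1 (p ^ e * m).
Proof.
move=> pp m0 /allP sm; apply/allP => q; rewrite primesM ?expn_gt0 ?(prime_gt0 pp)//.
case: e => [|e]; first by rewrite expn0 /= => /sm /ltnW.
by rewrite primesX// primes_prime// inE => /orP[/eqP ->|/sm /ltnW].
Qed.

Lemma logn_smooth (p e m : nat) : prime p -> (0 < m)%N ->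
  smooth p m -> logn p (p ^ e * m) = e.
Proof.
move=> pp m0 /allP sm.
rewrite lognM ?expn_gt0 ?(prime_gt0 pp)// pfactorK// logn_coprime ?addn0//.
rewrite prime_coprime//; apply/negP => pm.
by have := sm p; rewrite mem_primes pp m0 pm ltnn => /(_ isT).
Qed.

(** Existence of the decomposition [p ^ e * m] with [m] smooth below [p]; uniqueness comes from
    [logn_smooth]. *)
Lemma smooth_pfactor (p n : nat) : prime p -> (0 < n)%N -> smooth p.+1 n ->
  exists m, [/\ (0 < m)%N, smooth p m, coprime p m & n = (p ^ logn p n * m)%N].
Proof.
move=> pp n0 /allP sn; have [m cpm nE] := pfactor_coprime pp n0; exists m.
have m0 : (0 < m)%N by move: n0; rewrite nE muln_gt0 => /andP[].
split => //; last by rewrite mulnC.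
apply/allP => q qm; have := sn q; rewrite nE primesM ?expn_gt0 ?(prime_gt0 pp)// qm.
move=> /(_ isT); rewrite ltnS leq_eqVlt => /orP[/eqP qp|//].
by move: qm cpm; rewrite mem_primes qp prime_coprime// => /and3P[_ _ ->].
Qed.

Lemma prime_partial_prodS (F : nat -> R[i]) (N : nat) :
  prime_partial_prod F N.+1 =
  prime_partial_prod F N * (if prime N then F N else 1).
Proof.
by rewrite /prime_partial_prod big_mkcond big_nat_recr//= -big_mkcond.
Qed.

(** * Euler product of a multiplicative function *)

Section Product.
Variables (b F : nat -> R[i]).
Hypothesis b_mul : is_multiplicative b.
Hypothesis b_abs : abs_summable (fun n => if (0 < n)%N then b n else 0).
Hypothesis bF : forall p, prime p -> has_csum (fun e => b (p ^ e)%N) (F p).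

Lemma abs_summable_pfactor (p : nat) : prime p ->
  abs_summable (fun e => b (p ^ e)%N).
Proof.
move=> pp; have := abs_summable_inj (j := expn p) _ b_abs.
have -> : (fun n => if (0 < n)%N then b n else 0) \o expn p = fun e => b (p ^ e)%N.
  by apply/funext => e /=; rewrite expn_gt0 prime_gt0.
by apply => i j /eqP; rewrite eqn_exp2l ?prime_gt1// => /eqP.
Qed.

(** Induction on [N]: at a prime [p], the series over powers of [p] times the series over [p]-smooth
    numbers is a series over pairs [(e, m)], and [p ^ e * m] runs once through each positive
    [p.+1]-smooth number. *)
Lemma has_csum_smooth (N : nat) : b 1 = 1 ->
  has_csum (fun n => if smooth N n then if (0 < n)%N then b n else 0 else 0)
           (prime_partial_prod F N).
Proof.
move=> b1; elim: N => [|p IH].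
  rewrite /prime_partial_prod big_nil.
  (* The only positive number without prime factors is 1. *)
  apply: (has_sum1 (t := 1%N)) => [n n1|//].
  case: n n1 => [|[|n]]//= _; rewrite /smooth.
  have := pdiv_prime (isT : (1 < n.+2)%N); have := pdiv_dvd n.+2.
  move: (pdiv _) => q qd qp.
  by case: allP => // /(_ q); rewrite mem_primes qp qd => /(_ isT).
have [pp|npp] := boolP (prime p); last first.
  rewrite prime_partial_prodS (negbTE npp) mulr1.
  by apply: eq_has_sum IH => n; rewrite smoothS_not_prime.
rewrite prime_partial_prodS pp mulrC.
have h := has_sum_prod (abs_summable_pfactor pp)
  (abs_summable_restrict (smooth p) b_abs) (bF pp) IH.
apply: (has_sum_fiber (p := fun t => (p ^ t.1 * t.2)%N) h) => n.
have [/andP[n0 sn]|nsn] := boolP ((0 < n)%N && smooth p.+1 n); last first.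
  rewrite (_ : (if _ then _ else _) = 0); last by move: nsn; case: smooth; case: (0 < n)%N.
  apply: has_sum0 => -[e m] /=; case: eqP => // emn.
  case: ifP => sm; last by rewrite mulr0.
  case: ifP => m0; last by rewrite mulr0.
  case/negP: nsn; rewrite -emn muln_gt0 m0 expn_gt0 prime_gt0//=.
  exact: smooth_mul_pfactor.
rewrite n0 sn; have [m [m0 sm cpm nE]] := smooth_pfactor pp n0 sn.
apply: (has_sum1 (t := (logn p n, m))) => [[e m'] /= h'|/=]; last first.
  rewrite -nE eqxx sm m0 [in RHS]nE b_mul ?expn_gt0 ?(prime_gt0 pp)//.
  exact: coprimeXl.
case: eqP => // emn; case: ifP => sm'; last by rewrite mulr0.
case: ifP => m'0; last by rewrite mulr0.
have eE := logn_smooth e pp m'0 sm'; rewrite emn in eE.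
case/eqP: h'; rewrite eE; congr (_, _); apply/eqP.
have pe0 : (0 < p ^ e)%N by rewrite expn_gt0 prime_gt0.
by rewrite -(eqn_pmul2l pe0) emn -eE -nE.
Qed.

Lemma multiplicative_eq0 (n : nat) : b 1 = 0 -> (0 < n)%N -> b n = 0.
Proof. by move=> b1 n0; rewrite -(mul1n n) b_mul ?coprime1n// b1 mul0r. Qed.

(** Multiplicativity gives [b 1 * b 1 = b 1], so [b 1] is 0 or 1. If it is 0, then [b] vanishes on
    positive numbers; if it is 1, the smooth numbers exhaust the series. *)
Theorem euler_product (l : R[i]) :
  has_csum (fun n => if (0 < n)%N then b n else 0) l ->
  prime_partial_prod F @ \oo --> (l : C).
Proof.
move=> hl; have : b 1 * (b 1 - 1) = 0.
  by rewrite mulrBr mulr1 -b_mul// subrr.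
move=> /eqP; rewrite mulf_eq0 subr_eq0 => /orP[/eqP b1|/eqP b1].
  have l0 : l = 0.
    apply: (has_sum_unique hl); apply: has_sum0 => n.
    by case: ifP => // n0; exact: multiplicative_eq0.
  have F2 : F 2 = 0.
    apply: (has_sum_unique (bF (isT : prime 2))); apply: has_sum0 => e.
    by rewrite multiplicative_eq0// expn_gt0.
  (* From [N = 3] on, the partial product contains the factor at 2, which is 0. *)
  rewrite l0; apply: cvg_near_cst; exists 3%N => // N /= N3.
  rewrite /prime_partial_prod (big_cat_nat (n := 3))//=.
  by rewrite big_mkcond /= !big_nat_recr//= F2 mulr0 mul0r.
apply: (has_sum_exhaust (P := smooth) _ hl (fun N => has_csum_smooth b1)) => n.
case: ifP => [n0 _|]; last by rewrite eqxx.
exists n.+1 => // N /= nN; apply/allP => p; rewrite mem_primes => /and3P[_ _ pn].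
by rewrite (leq_ltn_trans (dvdn_leq _ pn)).
Qed.

End Product.
End Euler.

(** * Dirichlet series *)

Section DirichletSeries.
Variables (R : realType) (s : R).
Hypothesis s_gt1 : 1 < s.
Local Notation C := (R[i]^o).
Local Notation has_csum := (@has_sum R[i] C _).

Lemma powR2_lt1 : 2 `^ (1 - s) < 1 :> R.
Proof.
rewrite lt_neqAle powR_eq1 -[leRHS](powRr0 2) ler_powR ?ler1n ?subr_le0 ?(ltW s_gt1)//.
by rewrite pnatr_eq1 ltrn0 subr_eq0 (lt_eqF s_gt1).
Qed.

(* Cauchy condensation: the terms with [2 ^ K <= n < 2 ^ K.+1] add up to at
   most [r ^+ K] with [r = 2 `^ (1 - s)]. *)
Lemma riemann_sum_le (K : nat) :
  \sum_(1 <= n < 2 ^ K) (n%:R `^ s)^-1 <=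
  (1 - (2 `^ (1 - s)) ^+ K) / (1 - 2 `^ (1 - s)) :> R.
Proof.
have r1 := powR2_lt1; set r := 2 `^ (1 - s) in r1 *.
have r1' : 1 - r != 0 by rewrite subr_eq0 eq_sym lt_eqF.
elim: K => [|K IH]; first by rewrite big_geq// expr0 subrr mul0r.
have -> : (1 - r ^+ K.+1) / (1 - r) = (1 - r ^+ K) / (1 - r) + r ^+ K.
  by rewrite exprS; field.
rewrite (@big_cat_nat _ _ _ (2 ^ K)) ?expn_gt0 ?leq_exp2l//= lerD//.
have -> : r ^+ K = \sum_(2 ^ K <= n < 2 ^ K.+1) ((2 ^ K)%:R `^ s)^-1.
  rewrite sumr_const_nat expnS mul2n -addnn addnK -[RHS]mulr_natl natrX.
  rewrite /r powRB ?pnatr_eq0 ?implybT// powRr1// expr_div_n; congr (_ * _^-1).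
  rewrite -(powR_mulrn K (powR_ge0 2 s)) -(powR_mulrn K (ler0n R 2)).
  exact: powRAC.
apply: ler_sum_nat => n /andP[Kn _].
have K0 : (0 < 2 ^ K)%N by rewrite expn_gt0.
rewrite lef_pV2 ?posrE ?powR_gt0 ?ltr0n ?(leq_trans K0)//.
by rewrite ge0_ler_powR ?nnegrE ?ler_nat// (le_trans ler01)// ltW.
Qed.

Lemma npow_neq0 (n : nat) (t : R) : (0 < n)%N -> npow n t != 0.
Proof. by move=> n0; rewrite /npow fmorph_eq0 gt_eqF// powR_gt0 ?ltr0n. Qed.

Lemma npow1 (t : R) : npow 1 t = 1.
Proof. by rewrite /npow powR1. Qed.

Lemma npowM (m n : nat) (t : R) : npow (m * n) t = npow m t * npow n t.
Proof. by rewrite /npow natrM powRM// rmorphM. Qed.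

Lemma npowX (p e : nat) (t : R) : npow (p ^ e) t = npow p t ^+ e.
Proof. by elim: e => [|e IH]; rewrite ?npow1// expnS npowM IH exprS. Qed.

Lemma npow_natM (p e : nat) (t : R) : npow p (e%:R * t) = npow p t ^+ e.
Proof. by rewrite /npow mulrC powRrM powR_mulrn ?powR_ge0// rmorphXn. Qed.

(** Absorbs the factor [d] of Kluyver's formula: [d] over [d ^ s] is the inverse of
    [d ^ (s - 1)]. *)
Lemma npowB1 (n : nat) : npow n s = n%:R * npow n (s - 1).
Proof.
by rewrite /npow -mulr_powRB1 ?(lt_trans ltr01)// rmorphM /= rmorph_nat.
Qed.

Lemma cmod_npowV (n : nat) (t : R) : cmod (npow n t)^-1 = (n%:R `^ t)^-1.
Proof. by rewrite cmodV cmod_real ger0_norm ?powR_ge0. Qed.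

(** The bounded weight [w] covers both the constant 1 and [mobius]. *)
Lemma abs_summable_zeta (w : nat -> R[i]) : (forall n, cmod (w n) <= 1) ->
  abs_summable (fun n => if (0 < n)%N then w n / npow n s else 0).
Proof.
move=> w1; apply: (@abs_summable_nat _ _ (1 - 2 `^ (1 - s))^-1) => N.
have r1 := powR2_lt1.
apply: (@le_trans _ _ (\sum_(1 <= n < 2 ^ N) (n%:R `^ s)^-1)); last first.
  apply: le_trans (riemann_sum_le N) _.
  apply: ler_piMl; first by rewrite invr_ge0 subr_ge0 ltW.
  by rewrite gerBl exprn_ge0// powR_ge0.
rewrite (@le_trans _ _ (\sum_(1 <= n < N) (n%:R `^ s)^-1))//.
  rewrite (@big_nat_widenl _ _ _ 1 0)// [leRHS]big_mkcond /= ler_sum// => n _.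
  case: ifP => _; last by rewrite cmod0.
  by rewrite cmodM cmod_npowV; apply: ler_piMl; rewrite ?invr_ge0 ?powR_ge0.
have [N0|N0] := posnP N; first by rewrite N0 !big_geq.
rewrite [leRHS](@big_cat_nat _ _ _ N)//=; last by rewrite ltnW// ltn_expl.
by rewrite lerDl sumr_ge0// => n _; rewrite invr_ge0 powR_ge0.
Qed.

Lemma has_csum_zeta :
  has_csum (fun n => if (0 < n)%N then 1 / npow n s else 0) (zeta s)%:C.
Proof.
pose v n : R := if (0 < n)%N then (n%:R `^ s)^-1 else 0.
have v0 n : 0 <= v n by rewrite /v; case: ifP; rewrite // invr_ge0 powR_ge0.
have vE n : (v n)%:C = if (0 < n)%N then 1 / npow n s else 0.
  by rewrite /v; case: ifP => // _; rewrite div1r /npow fmorphV.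
have one_le1 (n : nat) : cmod (1 : R[i]) <= 1 by rewrite cmod1.
have [M hM] := abs_summable_zeta one_le1.
have [A|l hl] := has_sum_ge0 (M := M) v0.
  rewrite (le_trans _ (hM A))// ler_sum// => n _.
  by rewrite -vE cmod_real ger0_norm.
rewrite (_ : zeta s = l).
  by apply: eq_has_sum (has_sum_real_complex hl) => n; exact: vE.
(* [riemannR s] at index [n] is the term of [n.+1], hence the shift by one; the term of [v] at 0 is
   0. *)
apply/cvg_lim => //; have := has_sum_nat hl; rewrite -cvg_shiftS.
rewrite (_ : [sequence _]_n = series (riemannR s))//; apply/funext => N.
by rewrite /= big_nat_recl//= add0r.
Qed.

Lemma has_csum_mobius : has_csum
  (fun n => if (0 < n)%N then mobius R n / npow n s else 0) ((zeta s)%:C^-1).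
Proof.
have am := abs_summable_zeta (@cmod_mobius R).
have az : abs_summable (fun n => if (0 < n)%N then 1 / npow n s else 0).
  apply: (abs_summable_zeta (w := fun=> 1)) => n.
  by rewrite cmod1.
have [m hm] := abs_summable_has_sum am.
(* This identity shows at the same time that [zeta s] is nonzero. It holds because the product
   series has coefficients [mu * 1], which is 1 at 1 and 0 beyond. *)
suff mz : m * (zeta s)%:C = 1.
  have z0 : (zeta s)%:C != 0.
    by apply/eqP => z0; move/eqP: mz; rewrite z0 mulr0 eq_sym oner_eq0.
  by rewrite (_ : _^-1 = m)//; apply: (mulIf z0); rewrite mulVf.
have /has_csum_divisors h := has_sum_prod am az hm has_csum_zeta.
apply: (has_sum_unique (h _)) => [k n /=|].
  by move=> /orP[] /eqP ->; rewrite ?mul0r ?mulr0.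
apply: (has_sum1 (t := 1%N)) => [n n1|]; last first.
  by rewrite big_seq1 /= divn1 /= mobius1 npow1 divr1 mulr1.
have [->|n0] := posnP n; first by rewrite big1_seq// => d _; rewrite div0n mulr0.
rewrite (eq_big_seq (fun d => mobius R d / npow n s)).
  by rewrite -mulr_suml sum_mobius// (negbTE n1) mul0r.
move=> d; rewrite -dvdn_divisors// => dn /=.
have d0 : (0 < d)%N by rewrite (dvdn_gt0 n0).
rewrite d0 divn_gt0// dvdn_leq// div1r -mulrA -invfM -npowM.
by rewrite mulnC divnK.
Qed.

(** * The triple series, for both cases at once *)

Section DoubleSeries.
(** The kernel [K x y] stands for the Ramanujan sum c_x(y) in case (i) and c_y(x) in case (ii); [x]
    is the index of the expansion of [f], and [y] the index of its Dirichlet series. *)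
Variables (a w1 w2 f : nat -> R[i]) (K : nat -> nat -> R[i]) (W2 : R[i]).
Hypothesis aw_abs : abs_summable (fun t : nat * nat =>
  if (0 < t.1)%N && (0 < t.2)%N
  then a (t.1 * t.2)%N * w1 t.2 / npow t.1 (s - 1) else 0).
Hypothesis w2_le1 : forall n, cmod (w2 n) <= 1.
Hypothesis w2_sum : has_csum
  (fun n => if (0 < n)%N then w2 n / npow n s else 0) W2.
Hypothesis KE : forall x y, (0 < x)%N -> (0 < y)%N ->
  K x y = \sum_(d <- divisors (gcdn x y)) d%:R * w1 (x %/ d)%N * w2 (y %/ d)%N.
Hypothesis fE : forall y, (0 < y)%N ->
  has_csum (fun x => if (0 < x)%N then a x * K x y else 0) (f y).

Let b n := a n * dconv (fun d => (npow d (s - 1))^-1) w1 n.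

Let divisors_sumE n :
  \sum_(d <- divisors n) (if (0 < d)%N && (0 < n %/ d)%N
    then a (d * (n %/ d))%N * w1 (n %/ d)%N / npow d (s - 1) else 0) =
  if (0 < n)%N then b n else 0.
Proof.
have [->|n0] := posnP n; first by rewrite big1_seq// => d _; rewrite div0n andbF.
rewrite /b /dconv mulr_sumr; apply: eq_big_seq => d.
rewrite -dvdn_divisors// => dn; have d0 : (0 < d)%N by rewrite (dvdn_gt0 n0).
rewrite d0 divn_gt0// dvdn_leq//= mulnC divnK// -mulrA.
by congr (_ * _); rewrite mulrC.
Qed.

Lemma abs_summable_dconv : abs_summable (fun n => if (0 < n)%N then b n else 0).
Proof.
have h : forall u v : nat -> R[i], u =1 v -> abs_summable u -> abs_summable v.
  by move=> u v /funext ->.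
apply: h divisors_sumE _; apply: abs_summable_divisors aw_abs => k m /=.
by rewrite !lt0n -negb_or => ->.
Qed.

(* The triple series over [(d, k, m)] with term
   [a (d * k) * w1 k * w2 m / (d `^ (s - 1) * m `^ s)], summed once along
   [n = d * k] and once along [(x, y) = (d * k, d * m)]. *)
Lemma has_csum_double : exists2 G : R[i],
  has_csum (fun n => if (0 < n)%N then b n else 0) G &
  has_csum (fun y => if (0 < y)%N then f y / npow y s else 0) (G * W2).
Proof.
have [G hG] := abs_summable_has_sum aw_abs; exists G.
  apply: (eq_has_sum (V := C) divisors_sumE); apply: has_csum_divisors hG => k m /=.
  by rewrite !lt0n -negb_or => ->.
have h := has_sum_prod aw_abs (abs_summable_zeta w2_le1) hG w2_sum.
have {}h := has_csum_gcd _ h.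
have {}h : has_csum (fun t : nat * nat => if (0 < t.1)%N && (0 < t.2)%N
    then a t.1 * K t.1 t.2 / npow t.2 s else 0) (G * W2).
  apply: (eq_has_sum _ (h _)) => [[x y] /=|d k m /=]; last first.
    rewrite !lt0n; case: (d == 0)%N => /=; first by rewrite mul0r.
    by case: (k == 0)%N => /=; rewrite ?mul0r// => ->; rewrite mulr0.
  have [->|x0] := posnP x; first by rewrite big1_seq// => d _; rewrite div0n andbF mul0r.
  have [->|y0] := posnP y; first by rewrite big1_seq// => d _; rewrite div0n /= mulr0.
  rewrite KE// mulr_sumr mulr_suml; apply: eq_big_seq => d.
  rewrite -dvdn_divisors ?gcdn_gt0 ?x0// dvdn_gcd => /andP[dx dy].
  have d0 : (0 < d)%N by rewrite (dvdn_gt0 x0).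
  have yd0 : (0 < y %/ d)%N by rewrite divn_gt0// dvdn_leq.
  rewrite d0 yd0 divn_gt0// dvdn_leq//= mulnC divnK// -[in npow y s](divnK dy).
  rewrite npowM (npowB1 d); field.
  by rewrite !npow_neq0// pnatr_eq0 -lt0n d0.
(* Summing over [x] for fixed [y] recovers [f y] through its expansion. *)
apply: (has_sum_prodr h) => y.
have [->|y0] := posnP y; first by apply: has_sum0 => x /=; rewrite andbF.
rewrite mulrC; apply: (eq_has_sum _ (has_sumZ (npow y s)^-1 (fE y0))) => x /=.
by case: ifP => _ /=; rewrite [LHS]mulrC ?mul0r.
Qed.

End DoubleSeries.

End DirichletSeries.

(** * Local factors and the theorem *)

Section LocalFactors.
Variables (R : realType) (s : R) (a : nat -> R[i]).
Hypothesis s_gt1 : 1 < s.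
Hypothesis a_mul : is_multiplicative a.
Hypothesis a_abs :
  (\esum_(kn in [set kn : nat * nat | (0 < kn.1)%N /\ (0 < kn.2)%N])
     (cmod (a (kn.1 * kn.2)%N) / (kn.2%:R `^ (s - 1)))%:E < +oo)%E.
Local Notation C := (R[i]^o).
Local Notation has_csum := (@has_sum R[i] C _).

Let ipow (d : nat) : R[i] := (npow d (s - 1))^-1.

Lemma abs_summable_pairs (w : nat -> R[i]) : (forall n, cmod (w n) <= 1) ->
  abs_summable (fun t : nat * nat => if (0 < t.1)%N && (0 < t.2)%N
    then a (t.1 * t.2)%N * w t.2 / npow t.1 (s - 1) else 0).
Proof.
(* The hypothesis has its denominator on the second factor, the triple series on the first. *)
move=> w1; pose sw (t : nat * nat) := (t.2, t.1).
have sw_inj : injective sw by move=> [? ?] [? ?] [-> ->].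
have := abs_summable_inj sw_inj (abs_summable_esum _ a_abs).
move=> /(_ _)/abs_summable_le; apply => [t /=|t _]; last first.
  by rewrite divr_ge0 ?cmod_ge0 ?powR_ge0.
case: ifPn => [/andP[t1 t2]|_]; last by rewrite cmod0 cmod_ge0.
rewrite ifT; last exact/mem_set.
rewrite cmod_real ger0_norm ?divr_ge0 ?cmod_ge0 ?powR_ge0//.
rewrite !cmodM cmod_npowV mulnC ler_pM2r ?invr_gt0 ?powR_gt0 ?ltr0n//.
by rewrite ler_piMr ?cmod_ge0.
Qed.

Let ipow_le1 (p : nat) : (0 < p)%N -> cmod (ipow p) <= 1.
Proof.
move=> p0; rewrite cmod_npowV invf_le1 ?powR_gt0 ?ltr0n//.
by rewrite -[leLHS](powRr0 p%:R) ler_powR ?ler1n// subr_ge0 ltW.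
Qed.

Let ipowX (p e : nat) : ipow (p ^ e) = ipow p ^+ e.
Proof. by rewrite /ipow npowX exprVn. Qed.

Let ipow_mul : is_multiplicative ipow.
Proof. by move=> m n _ _ _; rewrite /ipow npowM invfM. Qed.

Lemma mul_dconv_multiplicative (w : nat -> R[i]) : is_multiplicative w ->
  is_multiplicative (fun n => a n * dconv ipow w n).
Proof.
move=> wm m n m0 n0 cmn; rewrite a_mul// (dconv_multiplicative ipow_mul wm)//.
exact: mulrACA.
Qed.

Variable p : nat.
Hypothesis p_prime : prime p.

Let p_gt0 : (0 < p)%N. Proof. exact: prime_gt0. Qed.

Let expp_inj : injective (expn p).
Proof. by move=> i j /eqP; rewrite eqn_exp2l ?prime_gt1// => /eqP. Qed.

(** The part of the double series at pairs of powers of [p]; all convergence needed for the local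
    factors follows from it. *)
Lemma abs_summable_pow_pairs :
  abs_summable (fun t : nat * nat => a (p ^ (t.1 + t.2))%N * ipow p ^+ t.1).
Proof.
pose j (t : nat * nat) := (p ^ t.1, p ^ t.2)%N.
have j_inj : injective j by move=> [? ?] [? ?] [/expp_inj -> /expp_inj ->].
have := abs_summable_inj j_inj (abs_summable_pairs (w := fun=> 1) _).
move=> /(_ _)/abs_summable_le; apply => [t /=|n]; last by rewrite cmod1.
by rewrite !expn_gt0 p_gt0 /= mulr1 -expnD -ipowX.
Qed.

Lemma abs_summable_pow (j : nat) : abs_summable (fun e => a (p ^ (j + e))%N).
Proof.
(* The row with first exponent 0, where the weight [ipow p ^+ 0] is 1. *)
have ij : injective (fun e : nat => (0, j + e)%N).
  by move=> x y [] /addnI.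
have := abs_summable_inj ij abs_summable_pow_pairs.
by apply: abs_summable_le => e /=; rewrite add0n expr0 mulr1.
Qed.

Lemma abs_summable_pow_ipow (j : nat) :
  abs_summable (fun e => a (p ^ (j + e))%N * ipow p ^+ e).
Proof.
apply: abs_summable_le (abs_summable_pow j) => e.
by rewrite cmodM ler_piMr ?cmod_ge0// -ipowX ipow_le1// expn_gt0 p_gt0.
Qed.

(** With [x = ipow p], the convolution at [p ^ e] is [x ^+ e - x ^+ e.-1] for positive [e] and 1 for
    [e = 0]. Shifting the index in the subtracted part produces the differences of consecutive
    [a (p ^ e)]. *)
Lemma local_factor_mobius :
  let term e := (a (p ^ e)%N - a (p ^ e.+1)%N) / npow p (e%:R * (s - 1)) in
  summable_from 0 term /\
  has_csum (fun e => a (p ^ e)%N * dconv ipow (@mobius R) (p ^ e)) (sum_from 0 term).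
Proof.
move=> term.
have [A hA] := abs_summable_has_sum (abs_summable_pow_ipow 0).
have [B hB] := abs_summable_has_sum (abs_summable_pow_ipow 1).
have [|ht ->] := @sum_fromE R 0 term (A - B).
  apply: (eq_has_sum _ (has_sumB hA hB)) => e /=.
  by rewrite /term npow_natM -exprVn mulrBl.
split; first exact: ht.
have hB' : has_csum (fun e => if (0 < e)%N then a (p ^ e)%N * ipow p ^+ e.-1 else 0) B.
  apply: (has_sum_inj (j := succn)) hB => [x y []//|[//|e] /(_ e)].
  by rewrite eqxx.
apply: (eq_has_sum _ (has_sumB hA hB')) => e /=.
rewrite add0n dconv_pfactor//; case: e => [|e] /=.
  by rewrite big_nat1 expn0 mobius1 subr0 /ipow npow1 invr1 expr0 !mulr1.
rewrite -mulrBr big_nat_recr//= big_nat_recr//= subnn subSnn mobius1 mobius_pfactor//=.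
(* Only the last two terms survive: [mobius] vanishes at powers of [p] with exponent at least 2. *)
rewrite big_nat big1 ?add0r; last first.
  move=> i /andP[_ ie]; rewrite subSn ?(ltnW ie)// mobius_pfactor// subn_eq0.
  by rewrite leqNgt ie mulr0.
by rewrite !ipowX mulrN1 mulr1 addrC.
Qed.

(** The family [a (p ^ (j + k)) * ipow p ^+ j] is summed in two ways: the row of [j] gives the tail
    from [j], and the antidiagonal [e = j + k] gives the convolution at [p ^ e]. *)
Lemma local_factor_cst1 :
  let tail e1 := sum_from e1 (fun e2 => a (p ^ e2)%N) in
  let term e1 := tail e1 / npow p (e1%:R * (s - 1)) in
  [/\ (forall e1, summable_from e1 (fun e2 => a (p ^ e2)%N)),
      summable_from 0 term &
      has_csum (fun e => a (p ^ e)%N * dconv ipow (fun=> 1) (p ^ e)) (sum_from 0 term)].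
Proof.
move=> tail term.
have tailP j : has_csum (fun e => a (p ^ (j + e))%N) (tail j) /\
    summable_from j (fun e2 => a (p ^ e2)%N).
  have [t ht] := abs_summable_has_sum (abs_summable_pow j).
  suff /sum_fromE[st tE] : has_csum
      (fun e => if (j <= e)%N then a (p ^ e)%N else 0) t.
    by split; [rewrite /tail tE; exact: ht | exact: st].
  apply: (has_sum_inj (j := addn j)); first exact: addnI.
    move=> e je; case: ifP => // le; have := je (e - j)%N.
    by rewrite subnKC// eqxx.
  by apply: eq_has_sum ht => e /=; rewrite leq_addr.
have [L hL] := abs_summable_has_sum abs_summable_pow_pairs.
have [|st ->] := @sum_fromE R 0 term L.
  apply: (has_sum_prodl hL) => j /=.
  rewrite /term npow_natM -exprVn mulrC.
  apply: (eq_has_sum _ (has_sumZ (ipow p ^+ j) (tailP j).1)) => e.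
  by rewrite [LHS]mulrC.
split; [by move=> j; exact: (tailP j).2 | exact: st |].
apply: (has_sum_fiber (p := fun t => (t.1 + t.2)%N) hL) => e.
pose r := [seq (j, e - j)%N | j <- index_iota 0 e.+1].
have ur : uniq r by rewrite map_inj_uniq ?iota_uniq// => x y [].
rewrite (_ : _ * _ = \sum_(t <- r) (if (t.1 + t.2)%N == e
    then a (p ^ (t.1 + t.2))%N * ipow p ^+ t.1 else 0)).
  apply: has_sum_seq => // -[j k] jkr /=; case: eqP => // jke.
  case/negP: jkr; apply/mapP; exists j.
    by rewrite mem_index_iota /= ltnS -jke leq_addr.
  by rewrite -jke addKn.
rewrite big_map dconv_pfactor// mulr_sumr; apply: eq_big_nat => j /andP[_ je] /=.
by rewrite subnKC// eqxx mulr1 ipowX.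
Qed.

End LocalFactors.

Theorem theorem3p5 (R : realType) (s : R) (f a : nat -> R[i])
    (s_gt1 : 1 < s)
    (f_abs : abs_summable_from 1 (fun n : nat => f n / npow n s))
    (a_mul : is_multiplicative a)
    (a_abs : (\esum_(kn in [set kn : nat * nat | (0 < kn.1)%N /\ (0 < kn.2)%N])
                (cmod (a (kn.1 * kn.2)%N) / (kn.2%:R `^ (s - 1)))%:E
              < +oo)%E) :
  ((forall n : nat, (0 < n)%N ->
      abs_summable_from 1 (fun q : nat => a q * ramanujan_sum R q n) /\
      f n = sum_from 1 (fun q : nat => a q * ramanujan_sum R q n)) ->
   let term (p e : nat) : R[i] :=
     (a (p ^ e)%N - a (p ^ e.+1)%N) / npow p (e%:R * (s - 1)) in
   let factor (p : nat) : R[i] := sum_from 0 (term p) in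
   [/\ (forall p : nat, prime p -> summable_from 0 (term p)),
       prime_prod_cvg factor &
       sum_from 1 (fun n : nat => f n / npow n s)
       = (zeta s)%:C * prime_prod factor])
  /\
  ((forall q : nat, (0 < q)%N ->
      abs_summable_from 1 (fun n : nat => a n * ramanujan_sum R q n) /\
      f q = sum_from 1 (fun n : nat => a n * ramanujan_sum R q n)) ->
   let tail (p e1 : nat) : R[i] := sum_from e1 (fun e2 : nat => a (p ^ e2)%N) in
   let term (p e1 : nat) : R[i] := tail p e1 / npow p (e1%:R * (s - 1)) in
   let factor (p : nat) : R[i] := sum_from 0 (term p) in
   [/\ (forall p e1 : nat, prime p ->
          summable_from e1 (fun e2 : nat => a (p ^ e2)%N)),
       (forall p : nat, prime p -> summable_from 0 (term p)),
       prime_prod_cvg factor &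
       sum_from 1 (fun q : nat => f q / npow q s)
       = (zeta s)%:C^-1 * prime_prod factor]).
Proof.
have le1 (n : nat) : cmod (1 : R[i]) <= 1 by rewrite cmod1.
have c1 : is_multiplicative (fun=> 1 : R[i]) by exact: cst1_multiplicative.
(* Absolute convergence turns the ordered series into an unordered sum, which may be rearranged. *)
have has_sum_from1 (u : nat -> R[i]) :
    abs_summable_from 1 u ->
    has_sum (V := R[i]^o) (fun n => if (0 < n)%N then u n else 0) (sum_from 1 u).
  move=> /abs_summable_from_restrict /abs_summable_has_sum [l hl].
  by have [_ ->] := sum_fromE hl.
split => [hf term factor|hf tail term factor].
- have fE y : (0 < y)%N -> has_sum (V := R[i]^o)
      (fun x => if (0 < x)%N then a x * ramanujan_sum R x y else 0) (f y).
    by move=> y0; have [h ->] := hf _ y0; exact: has_sum_from1 h.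
  have aw := abs_summable_pairs a_abs (@cmod_mobius R).
  (* Case (i): [w1] is [mobius] and [w2] is 1, so the outer factor is [zeta s] and [G] is the Euler
     product. *)
  have [|G hG hL] := has_csum_double s_gt1 aw le1 (has_csum_zeta s_gt1) _ fE.
    move=> x y x0 y0; rewrite ramanujan_sumE//.
    by apply: eq_bigr => d _; rewrite mulr1.
  have loc q (qp : prime q) := local_factor_mobius s_gt1 a_abs qp.
  have bm := mul_dconv_multiplicative s a_mul (@mobius_multiplicative R).
  have cvgP := euler_product bm (abs_summable_dconv aw) (fun q qp => (loc q qp).2) hG.
  split => [q qp||]; first exact: (loc q qp).1.
    by apply/cvg_ex; exists G.
  rewrite (sum_fromE hL).2 mulrC; congr (_ * _); apply: esym.
  exact: (cvg_lim (@norm_hausdorff _ R[i]^o) cvgP).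
- have fE y : (0 < y)%N -> has_sum (V := R[i]^o)
      (fun x => if (0 < x)%N then a x * ramanujan_sum R y x else 0) (f y).
    by move=> y0; have [h ->] := hf _ y0; exact: has_sum_from1 h.
  have aw := abs_summable_pairs a_abs (w := fun=> 1) le1.
  (* Case (ii) exchanges the weights, and the outer factor becomes the inverse of [zeta s]; the
     kernel has its arguments swapped, hence [gcdnC] below. *)
  have [|G hG hL] := has_csum_double (w1 := fun=> 1) s_gt1 aw
    (@cmod_mobius R) (has_csum_mobius s_gt1) _ fE.
    move=> x y x0 y0; rewrite ramanujan_sumE// gcdnC.
    by apply: eq_bigr => d _; rewrite mulr1.
  have loc q (qp : prime q) := local_factor_cst1 a_abs qp.
  have bm := mul_dconv_multiplicative s a_mul c1.
  have bF q (qp : prime q) := let: And3 _ _ h := loc q qp in h.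
  have cvgP := euler_product bm (abs_summable_dconv (w1 := fun=> 1) aw) bF hG.
  split => [q e1 qp|q qp||].
  + by have [h _ _] := loc q qp; exact: h.
  + by have [_ h _] := loc q qp; exact: h.
  + by apply/cvg_ex; exists G.
  rewrite (sum_fromE hL).2 mulrC; congr (_ * _); apply: esym.
  exact: (cvg_lim (@norm_hausdorff _ R[i]^o) cvgP).
Qed.
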